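(* Let $(Y,\lambda)\in\{-1,1\}\times\{-1,1\}^m$ follow the Ising model $$P(Y,\lambda)=\frac1Z\exp\Big(\theta_Y Y+\sum_{i}\theta_i\lambda_iY+\sum_{(i,j)\in E_\lambda}\theta_{ij}\lambda_i\lambda_j\Big),$$ with all canonical parameters nonnegative. Here $E_\lambda$ is a set of $|E_\lambda|=d$ unordered pairs of distinct sources, each source in at most one pair. Suppose the model is learned from $n_L$ i.i.d. labeled samples $(y^{(t)},\lambda^{(t)})_{t=1}^{n_L}$ of $(Y,\lambda)$, using the accuracy estimates $\tilde a_i^L=\frac1{n_L}\sum_{t=1}^{n_L}\lambda_i^{(t)}y^{(t)}$ together with the inference rule below. Then the excess generalization error satisfies $$R_L^e\le\frac{m}{2n_L}+\mathcal B_I+o(1/n_L),\qquad\text{where }\mathcal B_I=\sum_{(i,j)\in E_\lambda}I(\lambda_i;\lambda_j\mid Y).$$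
   Context: Inference rule. Set $$\tilde P(\lambda_i=\pm1\mid Y=1)=\frac{1\pm\tilde a_i}{2},\qquad \tilde P(\lambda_i=\pm1\mid Y=-1)=\frac{1\mp\tilde a_i}{2}.$$ Then define $$\tilde P(Y=y\mid\lambda=s)=\frac{\prod_i\tilde P(\lambda_i=s_i\mid Y=y)P(Y=y)}{\hat P(\lambda=s)},$$ where $P(Y=y)$ is the known true class balance and $\hat P$ is the empirical distribution of the source vectors in the dataset. Loss and errors. The loss is $$l(\tilde Y,Y)=-\frac{1+Y}{2}\log\tilde P(Y=1\mid\lambda)-\frac{1-Y}{2}\log\tilde P(Y=-1\mid\lambda).$$ The generalization error $R_L$ is $\mathbb E[l(\tilde Y,Y)]$, with expectation over a fresh $(Y,\lambda)\sim P$ and over the dataset. The excess generalization error is $R_L^e=R_L-H(Y\mid\lambda)$. $I(\cdot;\cdot\mid Y)$ denotes conditional mutual information under $P$.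
   Formalization: The loss is undefined or infinite with positive probability (fresh λ with empirical probability 0, or an accuracy estimate ±1 giving log 0); the formal statement sets x/0 = 0 and log 0 = 0, so the loss is 0 in these degenerate events. *)

(* Defs.v *)
From HB Require Import structures.
From mathcomp Require Import all_boot all_order all_algebra.
From mathcomp Require Import reals sequences exp.
Set Implicit Arguments. Unset Strict Implicit. Unset Printing Implicit Defensive.
Import Order.TTheory GRing.Theory Num.Theory.
Local Open Scope ring_scope.

Section Ising.
Variable R : realType.
Variable m : nat.

Definition spin (b : bool) : R := if b then 1 else -1.

Definition outcome := (bool * {ffun 'I_m -> bool})%type.

(* canonical parameters theta_Y, theta_i, theta_ij, and the edge set E_lambda;
   an unordered pair {i,j} is represented by the ordered pair (i,j) with i < j *)
Variables (thY : R) (th : 'I_m -> R) (thE : 'I_m -> 'I_m -> R)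
          (E : {set 'I_m * 'I_m}).

Definition ising_weight (x : outcome) : R :=
  expR (thY * spin x.1 + \sum_i th i * spin (x.2 i) * spin x.1
        + \sum_(e in E) thE e.1 e.2 * spin (x.2 e.1) * spin (x.2 e.2)).

Definition ising_Z : R := \sum_(x : outcome) ising_weight x.

Definition P (x : outcome) : R := ising_weight x / ising_Z.

Definition Pr (A : pred outcome) : R := \sum_(x : outcome | A x) P x.

Definition PY (y : bool) : R := Pr (fun x => x.1 == y).
Definition Plam (s : {ffun 'I_m -> bool}) : R := Pr (fun x => x.2 == s).

Definition cond_entropy : R :=
  - \sum_(x : outcome) P x * ln (P x / Plam x.2).

Definition cmi (i j : 'I_m) : R :=
  \sum_(y : bool) \sum_(a : bool) \sum_(b : bool)
    Pr (fun x => [&& x.1 == y, x.2 i == a & x.2 j == b]) *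
    ln (Pr (fun x => [&& x.1 == y, x.2 i == a & x.2 j == b]) * PY y /
        (Pr (fun x => (x.1 == y) && (x.2 i == a)) *
         Pr (fun x => (x.1 == y) && (x.2 j == b)))).

Definition B_I : R := \sum_(e in E) cmi e.1 e.2.

Variable n : nat.

Definition dataset := {ffun 'I_n -> outcome}.

Definition Pdata (D : dataset) : R := \prod_(t < n) P (D t).

Definition acc_est (D : dataset) (i : 'I_m) : R :=
  n%:R^-1 * \sum_(t < n) spin ((D t).2 i) * spin (D t).1.

Definition Ptilde_src (D : dataset) (i : 'I_m) (s y : bool) : R :=
  if y then (if s then (1 + acc_est D i) / 2 else (1 - acc_est D i) / 2)
       else (if s then (1 - acc_est D i) / 2 else (1 + acc_est D i) / 2).

Definition Phat (D : dataset) (s : {ffun 'I_m -> bool}) : R :=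
  n%:R^-1 * (#|[set t : 'I_n | (D t).2 == s]|)%:R.

Definition Ptilde_Y (D : dataset) (y : bool) (s : {ffun 'I_m -> bool}) : R :=
  (\prod_i Ptilde_src D i (s i) y) * PY y / Phat D s.

Definition loss (D : dataset) (x : outcome) : R :=
  - ((1 + spin x.1) / 2) * ln (Ptilde_Y D true x.2)
  - ((1 - spin x.1) / 2) * ln (Ptilde_Y D false x.2).

Definition gen_error : R :=
  \sum_(D : dataset) Pdata D * \sum_(x : outcome) P x * loss D x.

Definition excess_error : R := gen_error - cond_entropy.

End Ising.

(* Main.v *)
Require Import Defs.
From mathcomp Require Import all_boot all_order all_algebra.
From mathcomp Require Import reals sequences exp.
From mathcomp Require Import classical_sets topology normedtype derive realfun.
From mathcomp Require Import ring lra.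
Set Implicit Arguments. Unset Strict Implicit. Unset Printing Implicit Defensive.
Import Order.TTheory GRing.Theory Num.Theory.
Local Open Scope ring_scope.

(** Write [pi_ib] for the probability that [lambda_i * Y] is [1] ([b = true]) or
    [-1] ([b = false]); by spin-flip symmetry it is also its probability given
    [Y], and [Ptilde_src] is the corresponding empirical frequency. If every
    outcome occurs in the dataset, the excess risk is the sum of three terms:
    - [E ln (P(lambda | Y) / \prod_i P(lambda_i | Y))], which equals [B_I] because
      given [Y] the blocks of the matching are independent;
    - minus the Kullback-Leibler divergence from [Plam] to [Phat], at most [0];
    - for each source, the divergence from [pi_i] to its empirical version. By
      [- ln (1 + u) <= - u + (1/2 + eta) u^2 + K ln n u^4], its expectation is at
      most [(1/2 + eta) / n + O(ln n / n^2)]: the linear terms cancel, the second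
      moments add up to exactly [1 / n] and the fourth moments are [O(1 / n^2)].
    The datasets missing an outcome have probability [O(1 / n^2)], again by the
    fourth moment bound, and excess risk [O(ln n)]. *)

(** * Moments of empirical means *)

(** Since [1 - x <= expR (- x)], the product [expR x * (1 - x)] is at most [1], while [(1 + x + 2
    x^2) (1 - x) = 1 + x^2 (1 - 2 x)] is at least [1] for [x <= 1/2]. *)
Lemma expR_le_quadratic (R : realType) (x : R) :
  x <= 1 / 2 -> expR x <= 1 + x + 2 * x ^+ 2.
Proof.
move=> hx; have h1 : 1 - x <= expR (- x) by exact: expR_ge1Dx.
have := expR_gt0 x; have := expRN x; move=> hN hp.
have hm : expR x * expR (- x) = 1 by rewrite hN mulfV ?gt_eqF.
have h2 : expR x * (1 - x) <= 1 by rewrite -[leRHS]hm ler_wpM2l ?(ltW hp).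
have x2 : 0 <= x ^+ 2 by exact: sqr_ge0.
rewrite -(@ler_pM2r _ (1 - x)); last by lra.
apply: (le_trans h2).
have -> : (1 + x + 2 * x ^+ 2) * (1 - x) = 1 + x ^+ 2 * (1 - 2 * x) by ring.
by rewrite lerDl mulr_ge0 //; lra.
Qed.

(** For [x >= 0], raise [x / 4 <= expR (x / 4)] to the fourth power, which gives [256 = 4^4]; the
    second exponential covers negative [x] by symmetry. *)
Lemma pow4_le_expR (R : realType) (x : R) :
  x ^+ 4 <= 256 * (expR x + expR (- x)).
Proof.
wlog x0 : x / 0 <= x.
  move=> H; case: (leP 0 x) => [/H//|/ltW x0].
  have := H (- x); rewrite oppr_ge0 opprK => /(_ x0).
  by rewrite addrC (_ : (- x) ^+ 4 = x ^+ 4) //; ring.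
have h : (x / 4) ^+ 4 <= expR x.
  have -> : expR x = expR (x / 4) ^+ 4 by rewrite -expRM_natl; congr expR; lra.
  by rewrite ler_pXn2r ?nnegrE ?expR_ge0 ?divr_ge0 // (le_trans _ (expR_ge1Dx _)) // lerDr.
have := expR_ge0 (- x).
have : (x / 4) ^+ 4 = x ^+ 4 / 256 by field.
by move: h; set y := x ^+ 4; lra.
Qed.

Section Empirical.
Variables (R : realType) (T : finType) (p : T -> R).

Definition sample_mean (n : nat) (D : {ffun 'I_n -> T}) (f : T -> R) : R :=
  n%:R^-1 * \sum_(t < n) f (D t).

Definition Esample (n : nat) (F : {ffun 'I_n -> T} -> R) : R :=
  \sum_(D : {ffun 'I_n -> T}) (\prod_(t < n) p (D t)) * F D.

Hypothesis p_ge0 : forall x, 0 <= p x.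
Hypothesis p_sum1 : \sum_x p x = 1.

Lemma ler_Esample (n : nat) (F G : {ffun 'I_n -> T} -> R) :
  (forall D, F D <= G D) -> Esample F <= Esample G.
Proof.
by move=> FG; apply: ler_sum => D _; rewrite ler_wpM2l // prodr_ge0.
Qed.

Lemma eq_Esample (n : nat) (F G : {ffun 'I_n -> T} -> R) :
  F =1 G -> Esample F = Esample G.
Proof. by move=> FG; apply: eq_bigr => D _; rewrite FG. Qed.

Lemma EsampleD (n : nat) (F G : {ffun 'I_n -> T} -> R) :
  Esample (fun D => F D + G D) = Esample F + Esample G.
Proof. by rewrite /Esample -big_split; apply: eq_bigr => D _; rewrite mulrDr. Qed.

Lemma EsampleZ (n : nat) (c : R) (F : {ffun 'I_n -> T} -> R) :
  Esample (fun D => c * F D) = c * Esample F.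
Proof. by rewrite /Esample mulr_sumr; apply: eq_bigr => D _; rewrite mulrCA. Qed.

Lemma Esample_sum (n : nat) (I : finType) (F : I -> {ffun 'I_n -> T} -> R) :
  Esample (fun D => \sum_i F i D) = \sum_i Esample (F i).
Proof.
by rewrite /Esample exchange_big; apply: eq_bigr => D _; rewrite mulr_sumr.
Qed.

(** Independence of the draws: distributivity expands the product of sums into a sum over all
    datasets. *)
Lemma Esample_prod (n : nat) (g : 'I_n -> T -> R) :
  Esample (fun D => \prod_(t < n) g t (D t)) = \prod_(t < n) \sum_x p x * g t x.
Proof.
rewrite bigA_distr_bigA; apply: eq_bigr => D _.
by rewrite -big_split.
Qed.

Lemma Esample_cst (n : nat) (c : R) : Esample (fun _ : {ffun 'I_n -> T} => c) = c.
Proof.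
have := @Esample_prod n (fun _ _ => 1).
rewrite [RHS]big1 => [h|t _]; last by rewrite -[RHS]p_sum1; apply: eq_bigr => x _; rewrite mulr1.
rewrite -[RHS]mulr1 -h -EsampleZ; apply: eq_bigr => D _.
by rewrite big1_eq mulr1.
Qed.

Variable f : T -> R.
Hypothesis f_mean0 : \sum_x p x * f x = 0.

(** The integrand is a product over all positions [v] with factor [1] away from [t] and [u], so the
    expectation factorizes; for [t != u] the factor at [t] is the mean of [f], which is zero. Hence
    only diagonal pairs contribute to the second moment. *)
Lemma Esample_two_points (n : nat) (t u : 'I_n) :
  Esample (fun D : {ffun 'I_n -> T} => f (D t) * f (D u)) =
  if t == u then \sum_x p x * f x ^+ 2 else 0.
Proof.
pose g v x := (if v == t then f x else 1) * (if v == u then f x else 1).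
have E D : f (D t) * f (D u) = \prod_(v < n) g v (D v).
  by rewrite /g big_split /= -!big_mkcond /= !big_pred1_eq.
rewrite (eq_Esample E) Esample_prod.
case: eqVneq => [tu|tu].
  subst u.
  rewrite (bigD1 t) //= [X in _ * X]big1 ?mulr1 => [|v vt].
    by apply: eq_bigr => x _; rewrite /g eqxx expr2.
  by rewrite -[RHS]p_sum1; apply: eq_bigr => x _; rewrite /g (negbTE vt) !mulr1.
rewrite (bigD1 t) //= -[X in X * _]/(\sum_x _) (_ : \sum_x _ = 0) ?mul0r //.
by rewrite -[RHS]f_mean0; apply: eq_bigr => x _; rewrite /g eqxx (negbTE tu) mulr1.
Qed.

Lemma sample_mean_moment2 (n : nat) : (0 < n)%N ->
  Esample (fun D : {ffun 'I_n -> T} => sample_mean D f ^+ 2) =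
  n%:R^-1 * \sum_x p x * f x ^+ 2.
Proof.
move=> n0; have nz : n%:R != 0 :> R by rewrite pnatr_eq0 -lt0n.
have E D : sample_mean D f ^+ 2 =
    n%:R^-1 ^+ 2 * \sum_(t < n) \sum_(u < n) f (D t) * f (D u).
  by rewrite /sample_mean exprMn; congr (_ * _); rewrite expr2 big_distrlr.
rewrite (eq_Esample E) EsampleZ Esample_sum.
under eq_bigr => t _ do rewrite Esample_sum.
under eq_bigr => t _.
  under eq_bigr => u _ do rewrite Esample_two_points eq_sym.
  rewrite -big_mkcond big_pred1_eq; over.
rewrite sumr_const card_ord -[X in _ * X]mulr_natl mulrA; congr (_ * _).
by rewrite expr2 -mulrA mulVf ?mulr1.
Qed.

Hypothesis f_le1 : forall x, `|f x| <= 1.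

(** The expectation is the [n]-th power of one factor. As [f] has mean zero, that factor is at most
    [1 + 2 h^2 <= expR (2 h^2)], and [n h^2 = 1]. *)
Lemma Esample_expR_le (n : nat) (h : R) :
  (0 < n)%N -> h ^+ 2 = n%:R^-1 -> `|h| <= 1 / 2 ->
  Esample (fun D : {ffun 'I_n -> T} => expR (h * \sum_(t < n) f (D t))) <= expR 2.
Proof.
move=> n0 h2 hle; have nz : n%:R != 0 :> R by rewrite pnatr_eq0 -lt0n.
have E D : expR (h * \sum_(t < n) f (D t)) = \prod_(t < n) expR (h * f (D t)).
  by rewrite mulr_sumr expR_sum.
rewrite (eq_Esample E).
rewrite (Esample_prod (fun _ x => expR (h * f x))) prodr_const card_ord.
have step : \sum_x p x * expR (h * f x) <= expR (2 * h ^+ 2).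
  apply: le_trans (expR_ge1Dx _).
  have -> : 1 + 2 * h ^+ 2 = \sum_x p x * (1 + h * f x + 2 * h ^+ 2).
    under [RHS]eq_bigr => x _ do rewrite !mulrDr mulr1 mulrCA.
    by rewrite !big_split /= p_sum1 -mulr_sumr f_mean0 mulr0 addr0 -mulr_suml p_sum1 mul1r.
  apply: ler_sum => x _; rewrite ler_wpM2l //.
  have hf : `|h * f x| <= 1 / 2.
    by rewrite normrM (le_trans _ hle) // ler_piMr.
  apply: le_trans (expR_le_quadratic _) _; first exact: le_trans (ler_norm _) hf.
  rewrite lerD2l ler_wpM2l // exprMn ler_piMr ?sqr_ge0 //.
  by rewrite -real_normK ?num_real // expr_le1.
apply: le_trans (lerXn2r n _ _ step) _; rewrite ?nnegrE ?expR_ge0 ?sumr_ge0 //.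
  by move=> x _; rewrite mulr_ge0 ?expR_ge0.
by rewrite -expRM_natl h2 mulrC -mulrA mulVf ?mulr1.
Qed.

(* Chernoff-type argument: with [h = 1 / sqrt n] the exponential moments of
   [h * S] are bounded uniformly in [n], and they dominate its fourth moment. *)
Lemma sample_mean_moment4 (n : nat) : (4 <= n)%N ->
  Esample (fun D : {ffun 'I_n -> T} => sample_mean D f ^+ 4) <=
  512 * expR 2 / n%:R ^+ 2.
Proof.
move=> n4; have n0 : (0 < n)%N by exact: leq_trans n4.
have np : 0 < n%:R :> R by rewrite ltr0n.
pose h : R := Num.sqrt n%:R^-1.
have h2 : h ^+ 2 = n%:R^-1 by rewrite sqr_sqrtr ?invr_ge0 ?ler0n.
have h0 : 0 <= h by exact: sqrtr_ge0.
(* Equivalent to [4 <= n]. *)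
have hle : h <= 1 / 2.
  rewrite -(@ler_pXn2r _ 2) ?nnegrE ?divr_ge0 // h2 mul1r exprVn lef_pV2 ?posrE ?exprn_gt0 //.
  by rewrite -natrX ler_nat.
pose M (s : R) := Esample (fun D : {ffun 'I_n -> T} => expR (s * \sum_(t < n) f (D t))).
have M1 : M h <= expR 2 by apply: Esample_expR_le; rewrite ?ger0_norm.
have M2 : M (- h) <= expR 2 by apply: Esample_expR_le; rewrite ?sqrrN ?normrN ?ger0_norm.
(* [512 = 2 * 256]: there are two exponential moments, each at most [expR 2]. *)
have -> : 512 * expR 2 / n%:R ^+ 2 = n%:R ^- 2 * (256 * (expR 2 + expR 2)) :> R.
  by field; rewrite gt_eqF.
apply: le_trans (_ : n%:R ^- 2 * (256 * (M h + M (- h))) <= _); last first.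
  by rewrite ler_wpM2l ?invr_ge0 ?exprn_ge0 ?ler0n // ler_wpM2l // lerD.
rewrite /M -EsampleD -!EsampleZ; apply: ler_Esample => D.
rewrite /sample_mean -h2; set S := \sum_(t < n) _.
rewrite (_ : (h ^+ 2 * S) ^+ 4 = (h ^+ 2) ^+ 2 * (h * S) ^+ 4); last by ring.
rewrite h2 exprVn ler_wpM2l ?invr_ge0 ?exprn_ge0 ?ler0n //.
by rewrite mulNr pow4_le_expR.
Qed.

End Empirical.

(** * Bounds on the logarithm *)

Section LogBounds.
Import numFieldNormedType.Exports.
Local Open Scope classical_set_scope.
Local Open Scope ring_scope.

(** The difference [f] of the two sides vanishes at [0], and its derivative
    [x ((1 + 2 eta) (1 + x) - 1) / (1 + x)] has the sign of [x] between [0] and [u]: the hypothesis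
    on [u] keeps the middle factor nonnegative. The mean value theorem is applied on each side of
    [0]. *)
Lemma ln_ge_quadratic (R : realType) (eta u : R) :
  0 < eta -> 1 <= (1 + 2 * eta) * (1 + u) ->
  u - (1 / 2 + eta) * u ^+ 2 <= ln (1 + u).
Proof.
move=> eta0 hu.
have pos x : 1 <= (1 + 2 * eta) * (1 + x) -> 0 < 1 + x.
  by move=> h; rewrite -(@pmulr_rgt0 _ (1 + 2 * eta)) ?(lt_le_trans _ h) //; lra.
pose f (x : R) := ln (1 + x) - x + (1 / 2 + eta) * (x * x).
pose df (x : R) := (1 + x)^-1 - 1 + (1 + 2 * eta) * x.
have der (x : R) : 0 < 1 + x -> is_derive x (1 : R) f (df x).
  move=> x0; have L := is_derive1_ln x0.
  have D : is_derive x (1 : R) (fun x : R => 1 + x) 1.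
    by apply: is_derive_eq; rewrite add0r mulr1.
  have C : is_derive x (1 : R) (fun x : R => ln (1 + x)) (1 + x)^-1.
    by apply: is_derive_eq (is_derive1_comp L D) _; rewrite /GRing.scale /= mulr1.
  rewrite /f; apply: is_derive_eq.
  by rewrite /df /GRing.scale /=; lra.
have dfE x : 0 < 1 + x -> df x = x * ((1 + 2 * eta) * (1 + x) - 1) / (1 + x).
  by move=> x0; rewrite /df; field; rewrite gt_eqF.
have f0 : f 0 = 0 by rewrite /f addr0 ln1; ring.
suff : f 0 <= f u by rewrite f0 /f expr2; lra.
have cont (a b : R) : 1 <= (1 + 2 * eta) * (1 + a) -> {within `[a, b], continuous f}.
  move=> ha; apply: derivable_within_continuous => x; rewrite in_itv /= => /andP[ax _].
  have /der [] // : 0 < 1 + x by apply: lt_le_trans (pos _ ha) _; lra.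
have [u0|u0] := leP 0 u.
  have [||c + +] := @MVT_segment R f df 0 u u0.
  - move=> x; rewrite in_itv /= => /andP[x0 _]; apply: der; lra.
  - by apply: cont; lra.
  rewrite in_itv /= => /andP[c0 _] e; rewrite -subr_ge0 e mulr_ge0 ?subr_ge0 //.
  have c1 : 0 < 1 + c by lra.
  rewrite dfE // divr_ge0 ?(ltW c1) // mulr_ge0 //.
  have : 0 <= eta * c by rewrite mulr_ge0 // ltW.
  by lra.
have [||c + +] := @MVT_segment R f df u 0 (ltW u0).
- move=> x; rewrite in_itv /= => /andP[x0 _]; apply: der.
  by apply: lt_trans (pos _ hu) _; lra.
- exact: cont.
rewrite in_itv /= => /andP[uc c0] e; rewrite -subr_le0 e.
have c1 : 0 < 1 + c by apply: lt_le_trans (pos _ hu) _; lra.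
rewrite mulr_le0_ge0 ?subr_ge0 ?(ltW u0) // dfE // mulr_le0_ge0 ?invr_ge0 ?(ltW c1) //.
rewrite mulr_le0_ge0 // subr_ge0 (le_trans hu) // ler_wpM2l; lra.
Qed.

End LogBounds.

(** For [u >= - r] with [r = 2 eta / (1 + 2 eta)] the quadratic bound applies. For [u < - r] the
    crude bound [L] is absorbed by the quartic term with [K = r^-4], as [u^4 >= r^4] and the other
    terms are nonnegative. Later [L] is [ln n]. *)
Lemma ln_ge_quartic (R : realType) (eta : R) : 0 < eta ->
  exists2 K : R, 0 <= K & forall u L : R,
    -1 < u -> 0 <= L -> - ln (1 + u) <= L ->
    - ln (1 + u) <= - u + (1 / 2 + eta) * u ^+ 2 + K * L * u ^+ 4.
Proof.
move=> eta0; pose r := 2 * eta / (1 + 2 * eta).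
have r0 : 0 < r by rewrite divr_gt0 //; lra.
exists (r ^- 4) => [|u L u1 L0 hL]; first by rewrite invr_ge0 exprn_ge0 // ltW.
have q0 : 0 <= r ^- 4 * L * u ^+ 4.
  by rewrite mulr_ge0 ?exprn_even_ge0 // mulr_ge0 // invr_ge0 exprn_even_ge0.
have [ur|ur] := leP (- r) u.
  have := @ln_ge_quadratic R eta u eta0.
  have -> : 1 <= (1 + 2 * eta) * (1 + u).
    have : (1 + 2 * eta) * (- r) <= (1 + 2 * eta) * u by rewrite ler_wpM2l //; lra.
    have -> : (1 + 2 * eta) * (- r) = - (2 * eta) by rewrite /r; field; lra.
    by lra.
  by move=> /(_ isT); lra.
have s0 : 0 <= (1 / 2 + eta) * u ^+ 2 by rewrite mulr_ge0 ?sqr_ge0 //; lra.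
have : L <= r ^- 4 * L * u ^+ 4; last by lra.
rewrite mulrAC ler_peMl // mulrC ler_pdivlMr ?exprn_gt0 // mul1r.
have -> : u ^+ 4 = (- u) ^+ 4 by ring.
have ru : r <= - u by rewrite lerNr ltW.
by rewrite ler_pXn2r ?nnegrE ?(le_trans (ltW r0) ru) ?(ltW r0).
Qed.

(** * Independence across blocks *)

Section BlockIndependence.
Variables (R : realType) (I K : finType) (b : I -> K).
Let S := {ffun I -> bool}.

Definition depends_on (A : pred I) (f : S -> R) : Prop :=
  forall s t : S, (forall i, A i -> s i = t i) -> f s = f t.

Lemma depends_onM (A : pred I) (f g : S -> R) :
  depends_on A f -> depends_on A g -> depends_on A (fun s => f s * g s).
Proof. by move=> hf hg s t st; rewrite (hf s t st) (hg s t st). Qed.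

(* The involution exchanging the coordinates outside [A] of two configurations
   turns [f s * g t] into [f s * g s]. *)
Lemma sum_depends_onM (A : pred I) (f g : S -> R) :
  depends_on A f -> depends_on (predC A) g ->
  (\sum_s f s) * (\sum_s g s) = #|S|%:R * \sum_s f s * g s.
Proof.
move=> hf hg; rewrite big_distrlr /= pair_big /=.
pose mix (s t : S) : S := [ffun i => if A i then s i else t i].
pose h (u : S * S) := (mix u.1 u.2, mix u.2 u.1).
have hK : involutive h.
  by move=> [s t]; congr pair; apply/ffunP => i; rewrite !ffunE /=; case: (A i).
rewrite (reindex_inj (inv_inj hK)) /=.
under eq_bigr => u _.
  rewrite (_ : f _ = f u.1); last by apply: hf => i Ai; rewrite ffunE Ai.
  rewrite (_ : g _ = g u.1); last by apply: hg => i /negbTE Ai; rewrite ffunE Ai.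
  over.
rewrite -(pair_big xpredT xpredT (fun s t : S => f s * g s)) /=.
by under eq_bigr => s _ do rewrite sumr_const -mulr_natl; rewrite -mulr_sumr.
Qed.

(** The uniform law makes all coordinates independent; weights that factor over blocks are treated
    as densities against it. *)
Definition uniform_mean (f : S -> R) : R := #|S|%:R^-1 * \sum_s f s.

Lemma card_config_neq0 : #|S|%:R != 0 :> R.
Proof. by rewrite pnatr_eq0 card_ffun card_bool expn_eq0. Qed.

Lemma uniform_meanM (A : pred I) (f g : S -> R) :
  depends_on A f -> depends_on (predC A) g ->
  uniform_mean (fun s => f s * g s) = uniform_mean f * uniform_mean g.
Proof.
move=> hf hg; rewrite /uniform_mean mulrACA (sum_depends_onM hf hg).
by rewrite -mulrA [X in _ = _ * X]mulrA mulVf ?mul1r // card_config_neq0.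
Qed.

(** Induction on a duplicate-free list of blocks: the product over the remaining blocks depends only
    on coordinates outside the first one. *)
Lemma uniform_mean_prod (F : K -> S -> R) :
  (forall k, depends_on (fun i => b i == k) (F k)) ->
  uniform_mean (fun s => \prod_k F k s) = \prod_k uniform_mean (F k).
Proof.
move=> hF; elim: (index_enum K) (index_enum_uniq K) => [|k r IH] /=.
  move=> _; rewrite big_nil /uniform_mean.
  under eq_bigr => s _ do rewrite big_nil.
  by rewrite sumr_const mulVf // card_config_neq0.
case/andP => kr /IH {}IH; rewrite big_cons -IH -(uniform_meanM (hF k)).
  by congr (_ * _); apply: eq_bigr => s _; rewrite big_cons.
move=> s t st; apply: eq_big_seq => l lr; apply: hF => i /eqP bil; apply: st.
by rewrite /= bil; apply: contraNneq kr => <-.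
Qed.

Variables (w : S -> R) (c : R) (W : K -> S -> R).
Hypothesis wE : forall s, w s = c * \prod_k W k s.
Hypothesis W_dep : forall k, depends_on (fun i => b i == k) (W k).
Hypothesis w_sum : \sum_s w s != 0.

Lemma sum_weight_prod (g : K -> S -> R) :
  (forall k, depends_on (fun i => b i == k) (g k)) ->
  \sum_s w s * \prod_k g k s =
  c * #|S|%:R * \prod_k uniform_mean (fun s => W k s * g k s).
Proof.
move=> hg; rewrite -uniform_mean_prod => [|k]; last exact: depends_onM.
rewrite -mulrA [#|S|%:R * _]mulrA mulfV ?card_config_neq0 // mul1r mulr_sumr.
by apply: eq_bigr => s _; rewrite wE -mulrA big_split.
Qed.

(** Numerators and normalization are all computed by [sum_weight_prod]; in the expectation of a
    single [g k], the uniform means of the other [W l] cancel against the normalization. *)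
Lemma block_independence (g : K -> S -> R) :
  (forall k, depends_on (fun i => b i == k) (g k)) ->
  (\sum_s w s * \prod_k g k s) / \sum_s w s =
  \prod_k ((\sum_s w s * g k s) / \sum_s w s).
Proof.
move=> hg; have cst k : depends_on (fun i => b i == k) (fun=> 1 : R) by [].
have E0 : \sum_s w s = c * #|S|%:R * \prod_k uniform_mean (W k).
  transitivity (\sum_s w s * \prod_(k : K) 1).
    by apply: eq_bigr => s _; rewrite big1_eq mulr1.
  rewrite (sum_weight_prod cst); congr (_ * _); apply: eq_bigr => k _; congr (_ * _).
  by apply: eq_bigr => s _; rewrite mulr1.
have E1 k : \sum_s w s * g k s = c * #|S|%:R *
    (uniform_mean (fun s => W k s * g k s) * \prod_(l | l != k) uniform_mean (W l)).
  (* A single [g k] is a product over all blocks whose other factors are [1]. *)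
  pose h l := if l == k then g l else fun=> 1.
  have hh l : depends_on (fun i => b i == l) (h l).
    by rewrite /h; case: ifP.
  transitivity (\sum_s w s * \prod_l h l s).
    apply: eq_bigr => s _; rewrite (bigD1 k) //= /h eqxx big1 ?mulr1 // => l /negbTE lk.
    by rewrite lk.
  rewrite (sum_weight_prod hh) (bigD1 k) //=; congr (_ * (_ * _)).
    by congr (_ * _); apply: eq_bigr => s _; rewrite /h eqxx.
  apply: eq_bigr => l /negbTE lk.
  by congr (_ * _); apply: eq_bigr => s _; rewrite /h lk mulr1.
have nz := w_sum; rewrite E0 mulf_eq0 negb_or in nz; case/andP: nz => c0 u0.
have uk k : uniform_mean (W k) != 0 by move/prodf_neq0: u0; apply.
rewrite sum_weight_prod // E0 -mulf_div divff // mul1r -prodf_div.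
apply: eq_bigr => k _; rewrite E1 -[RHS]mulf_div divff // mul1r.
have -> : \prod_l uniform_mean (W l) =
    uniform_mean (W k) * \prod_(l | l != k) uniform_mean (W l) by rewrite (bigD1 k).
rewrite -[RHS]mulf_div divff ?mulr1 //; apply/prodf_neq0 => l _; exact: uk.
Qed.

End BlockIndependence.

Lemma ln_prod (R : realType) (I : Type) (r : seq I) (A : pred I) (F : I -> R) :
  (forall i, A i -> 0 < F i) ->
  ln (\prod_(i <- r | A i) F i) = \sum_(i <- r | A i) ln (F i).
Proof.
move=> F0; suff : 0 < \prod_(i <- r | A i) F i /\
  ln (\prod_(i <- r | A i) F i) = \sum_(i <- r | A i) ln (F i) by case.
elim/big_rec2: _ => [|i x y Ai [x0 e]]; first by rewrite ltr01 ln1.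
by rewrite mulr_gt0 ?F0 // lnM ?posrE ?F0 // e.
Qed.

(** * The Ising model *)

Section IsingModel.
Variables (R : realType) (m : nat) (thY : R) (th : 'I_m -> R)
  (thE : 'I_m -> 'I_m -> R) (E : {set 'I_m * 'I_m}).

Local Notation outcome := (outcome m).
Local Notation P := (P thY th thE E).
Local Notation Pr := (Pr thY th thE E).
Local Notation PY := (PY thY th thE E).
Local Notation config := {ffun 'I_m -> bool}.

Lemma ising_Z_gt0 : 0 < ising_Z thY th thE E.
Proof.
rewrite /ising_Z (bigD1 (true, [ffun=> true])) //= ltr_pwDl ?expR_gt0 //.
by apply: sumr_ge0 => x _; rewrite expR_ge0.
Qed.

Lemma P_gt0 x : 0 < P x.
Proof. by rewrite divr_gt0 ?expR_gt0 ?ising_Z_gt0. Qed.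

Lemma P_ge0 x : 0 <= P x.
Proof. exact: ltW (P_gt0 x). Qed.

Lemma P_sum1 : \sum_x P x = 1.
Proof. by rewrite -mulr_suml mulfV // gt_eqF ?ising_Z_gt0. Qed.

Lemma Pr_gt0 (A : pred outcome) x : A x -> 0 < Pr A.
Proof.
move=> Ax; rewrite /Pr (bigD1 x) //= ltr_pwDl ?P_gt0 //.
by apply: sumr_ge0 => *; rewrite P_ge0.
Qed.

Lemma PY_gt0 y : 0 < PY y.
Proof. by apply: (@Pr_gt0 _ (y, [ffun=> true])). Qed.

Lemma Pr_fst (y : bool) (A : pred config) :
  Pr (fun x => (x.1 == y) && A x.2) = \sum_s P (y, s) * (A s)%:R.
Proof.
rewrite /Pr -(pair_big_dep (pred1 y) (fun _ s => A s) (fun z s => P (z, s))) /=.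
rewrite big_pred1_eq big_mkcond; apply: eq_bigr => s _.
by case: (A s); rewrite ?mulr1 ?mulr0.
Qed.

Lemma PYE y : PY y = \sum_s P (y, s).
Proof.
transitivity (Pr (fun x => (x.1 == y) && xpredT x.2)).
  by apply: eq_bigl => x; rewrite andbT.
by rewrite (Pr_fst y xpredT); apply: eq_bigr => s _; rewrite mulr1.
Qed.

Definition flip (x : outcome) : outcome := (~~ x.1, [ffun i => ~~ x.2 i]).

Lemma flipK : involutive flip.
Proof.
by move=> [y s]; rewrite /flip /= negbK; congr pair; apply/ffunP => i; rewrite !ffunE negbK.
Qed.

Lemma spinN c : spin R (~~ c) = - spin R c.
Proof. by case: c; rewrite /spin ?opprK. Qed.

(** Every term of the exponent that is quadratic in the spins is invariant under the global flip;
    only the linear term [thY * Y] changes sign. *)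
Lemma P_flip x : P (flip x) = P x * expR (- 2 * thY * spin R x.1).
Proof.
rewrite /Defs.P mulrAC -expRD; congr (expR _ / _); rewrite /= spinN.
under eq_bigr => i _ do rewrite ffunE spinN mulrN mulrN mulNr opprK.
under [X in _ + _ + X = _]eq_bigr => e _ do rewrite !ffunE !spinN mulrN mulrN mulNr opprK.
by ring.
Qed.

Lemma Pr_flip (y : bool) (A B : pred config) :
  (forall s : config, B [ffun i => ~~ s i] = A s) ->
  Pr (fun x => (x.1 == ~~ y) && B x.2) =
  expR (- 2 * thY * spin R y) * Pr (fun x => (x.1 == y) && A x.2).
Proof.
move=> BA; rewrite /Pr (reindex_inj (inv_inj flipK)) /= mulr_sumr.
rewrite (eq_bigl (fun x : outcome => (x.1 == y) && A x.2)); last first.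
  by move=> x; rewrite BA (inj_eq negb_inj).
by apply: eq_bigr => x /andP[/eqP <- _]; rewrite P_flip mulrC.
Qed.

(** The event that [lambda_i * Y] equals [1] ([c = true]) or [-1] ([c = false]); its probability is
    [pi_ic]. *)
Definition agreement (i : 'I_m) (c : bool) (x : outcome) : bool :=
  (x.2 i == x.1) == c.

(* The conditional law of [lambda_i * Y] given [Y] does not depend on [Y]:
   flipping all spins changes the weight only through [theta_Y]. *)
Lemma Pr_source_cond (i : 'I_m) (y a : bool) :
  Pr (fun x => (x.1 == y) && (x.2 i == a)) / PY y = Pr (agreement i (a == y)).
Proof.
set A := fun s : config => s i == a; set B := fun s : config => s i == ~~ a.
have BA (s : config) : B [ffun i => ~~ s i] = A s by rewrite /B /A ffunE (inj_eq negb_inj).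
have e1 := Pr_flip y BA.
have e2 := @Pr_flip y xpredT xpredT (fun=> erefl).
have PYT z : Pr (fun x => (x.1 == z) && xpredT x.2) = PY z.
  by apply: eq_bigl => x; rewrite andbT.
rewrite !PYT in e2.
have tot : PY y + PY (~~ y) = 1.
  rewrite -P_sum1 [RHS](bigID (fun x : outcome => x.1 == y)) /=; congr (_ + _).
  by apply: eq_bigl => x; case: (x.1); case: (y).
have -> : Pr (agreement i (a == y)) =
    Pr (fun x => (x.1 == y) && A x.2) + Pr (fun x => (x.1 == ~~ y) && B x.2).
  rewrite /Pr (bigID (fun x : outcome => x.1 == y)) /=; congr (_ + _).
    by apply: eq_bigl => x; rewrite /agreement /A; case: (x.1); case: (x.2 i); case: (y); case: (a).
  by apply: eq_bigl => x; rewrite /agreement /B; case: (x.1); case: (x.2 i); case: (y); case: (a).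
rewrite e1; have p0 := PY_gt0 y; move: tot e2.
set k := expR _; set q := PY (~~ y); set p := Pr _ => tot e2.
(* Here [k] is the ratio [PY (~~ y) / PY y], so adding the contributions of both classes amounts to
   dividing by [PY y]. *)
have hk : (1 + k) * PY y = 1 by rewrite -[RHS]tot e2; ring.
by rewrite -[LHS]mulr1 -hk; field; rewrite gt_eqF.
Qed.

End IsingModel.

(** * Factorization of the conditional law over the matching *)

Section Matching.
Variables (R : realType) (m : nat) (thY : R) (th : 'I_m -> R)
  (thE : 'I_m -> 'I_m -> R) (E : {set 'I_m * 'I_m}).
Hypothesis E_lt : forall e, e \in E -> (e.1 < e.2)%N.
Hypothesis E_disjoint : forall e f, e \in E -> f \in E -> e != f ->
  [disjoint [set e.1; e.2] & [set f.1; f.2]].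

Local Notation outcome := (outcome m).
Local Notation P := (P thY th thE E).
Local Notation Pr := (Pr thY th thE E).
Local Notation PY := (PY thY th thE E).
Local Notation config := {ffun 'I_m -> bool}.

Lemma matching_inj e f i : e \in E -> f \in E ->
  i \in [set e.1; e.2] -> i \in [set f.1; f.2] -> e = f.
Proof.
move=> eE fE ie jf; apply/eqP/negPn/negP => /(E_disjoint eE fE).
by move=> /pred0P /(_ i) /=; rewrite ie jf.
Qed.

(** Blocks are labeled by sources: a matched pair by its first endpoint, an unmatched source by
    itself. The label of a second endpoint names an empty block. *)
Definition block (i : 'I_m) : 'I_m :=
  if [pick e in E | e.2 == i] is Some e then e.1 else i.

Lemma block_snd e : e \in E -> block e.2 = e.1.
Proof.
move=> eE; rewrite /block; case: pickP => [f /andP[fE /eqP fe]|/(_ e)].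
  by rewrite (@matching_inj f e e.2) // -?fe !inE eqxx orbT.
by rewrite eE eqxx.
Qed.

Variant block_spec (i : 'I_m) : 'I_m -> Prop :=
| BlockSnd e of e \in E & i = e.2 : block_spec i e.1
| BlockSelf of (forall e, e \in E -> e.2 != i) : block_spec i i.

Lemma blockP i : block_spec i (block i).
Proof.
rewrite /block; case: pickP => [e /andP[eE /eqP ei]|h]; first by constructor.
by constructor => e eE; have := h e; rewrite eE /= => ->.
Qed.

Lemma matching_fst_snd e f : e \in E -> f \in E -> e.1 != f.2.
Proof.
move=> eE fE; apply/negP => /eqP ef.
have h : e = f by apply: (@matching_inj e f e.1) => //; rewrite !inE ?eqxx // ef eqxx orbT.
by have := E_lt eE; rewrite {1}ef h ltnn.
Qed.

Lemma block_fst e : e \in E -> block e.1 = e.1.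
Proof.
move=> eE; case: blockP => // f fE ef.
by have := matching_fst_snd eE fE; rewrite ef eqxx.
Qed.

Lemma block_eq_fst e i : e \in E -> (block i == e.1) = (i == e.1) || (i == e.2).
Proof.
move=> eE; apply/eqP/orP => [|[] /eqP ->]; [|exact: block_fst|exact: block_snd].
case: blockP => [f fE -> fe|_ ->]; [right|by left].
by rewrite (@matching_inj f e e.1) // -?fe !inE eqxx.
Qed.

Lemma block_eq_snd e i : e \in E -> (block i == e.2) = false.
Proof.
move=> eE; apply/negP; case: blockP => [f fE _|h /eqP ie].
  by rewrite (negbTE (matching_fst_snd fE eE)).
by have := h _ eE; rewrite ie eqxx.
Qed.

Lemma block_eq_unmatched k i :
  (forall e, e \in E -> (e.1 != k) && (e.2 != k)) -> (block i == k) = (i == k).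
Proof.
move=> hk; case: blockP => // e eE ->.
by have /andP[/negbTE -> /negbTE ->] := hk _ eE.
Qed.

Definition block_weight (y : bool) (k : 'I_m) (s : config) : R :=
  (\prod_(i | block i == k) expR (th i * spin R (s i) * spin R y)) *
  \prod_(e in E | e.1 == k) expR (thE e.1 e.2 * spin R (s e.1) * spin R (s e.2)).

Lemma P_block_weight (y : bool) (s : config) :
  P (y, s) = expR (thY * spin R y) / ising_Z thY th thE E *
    \prod_k block_weight y k s.
Proof.
rewrite mulrAC /Defs.P /ising_weight /= -addrA expRD; congr (_ * _ / _).
rewrite expRD big_split /= !expR_sum; congr (_ * _).
  by rewrite (partition_big block xpredT).
by rewrite (partition_big (fun e : 'I_m * 'I_m => e.1) xpredT).
Qed.

Lemma block_weight_dep (y : bool) (k : 'I_m) :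
  depends_on (fun i => block i == k) (block_weight y k).
Proof.
move=> s t st; rewrite /block_weight; congr (_ * _).
  by apply: eq_bigr => i ik; rewrite st.
apply: eq_bigr => e /andP[eE /eqP ek].
by rewrite !st // -ek ?block_fst ?block_snd.
Qed.

Definition block_agree (s : config) (k : 'I_m) (t : config) : bool :=
  [forall i, (block i == k) ==> (t i == s i)].

(** Block independence is applied to the indicators of agreeing with [s] on each block, whose
    product over all blocks is the indicator of [s]. *)
Lemma P_cond_block (y : bool) (s : config) :
  P (y, s) / PY y =
  \prod_k (Pr (fun x => (x.1 == y) && block_agree s k x.2) / PY y).
Proof.
have hg k : depends_on (fun i => block i == k) (fun t => (block_agree s k t)%:R : R).
  move=> t u tu; congr ((nat_of_bool _)%:R); apply: eq_forallb => i.
  by case: eqP => //= /eqP bi; rewrite tu.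
have nz : \sum_t P (y, t) != 0 by rewrite -PYE gt_eqF ?PY_gt0.
have := block_independence (P_block_weight y) (block_weight_dep y) nz hg.
under [in X in _ = X -> _]eq_bigr => k _ do rewrite -Pr_fst -PYE.
rewrite -PYE => <-; congr (_ / _).
rewrite (bigD1 s) //= [X in _ * X]big1 => [|k _]; last first.
  by rewrite (_ : block_agree _ _ _) //; apply/forallP => i; apply/implyP.
rewrite mulr1 big1 ?addr0 // => t ts.
have /existsP[i ti] : [exists i, t i != s i].
  apply: contraR ts => /existsPn h; apply/eqP/ffunP => i.
  by apply/eqP; have := h i; rewrite negbK.
rewrite (bigD1 (block i)) //= (_ : block_agree _ _ _ = false) ?mul0r ?mulr0 //.
by apply/negbTE/forallPn; exists i; rewrite eqxx.
Qed.

Definition source_cond (x : outcome) (i : 'I_m) : R :=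
  Pr (fun x' => (x'.1 == x.1) && (x'.2 i == x.2 i)) / PY x.1.

(** The pointwise ratio of the joint conditional law of the two endpoints given [Y] to the product
    of their conditional laws; the mean of its logarithm is the conditional mutual information. *)
Definition edge_ratio (x : outcome) (e : 'I_m * 'I_m) : R :=
  Pr (fun x' => [&& x'.1 == x.1, x'.2 e.1 == x.2 e.1 & x'.2 e.2 == x.2 e.2]) *
    PY x.1 /
  (Pr (fun x' => (x'.1 == x.1) && (x'.2 e.1 == x.2 e.1)) *
   Pr (fun x' => (x'.1 == x.1) && (x'.2 e.2 == x.2 e.2))).

Lemma source_pr_gt0 (x : outcome) (i : 'I_m) :
  0 < Pr (fun x' => (x'.1 == x.1) && (x'.2 i == x.2 i)).
Proof. by apply: (@Pr_gt0 _ _ _ _ _ _ _ x); rewrite !eqxx. Qed.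

Lemma source_cond_gt0 (x : outcome) (i : 'I_m) : 0 < source_cond x i.
Proof. by rewrite divr_gt0 ?PY_gt0 ?source_pr_gt0. Qed.

Lemma edge_ratio_gt0 (x : outcome) e : 0 < edge_ratio x e.
Proof.
rewrite divr_gt0 ?mulr_gt0 ?PY_gt0 ?source_pr_gt0 //.
by apply: (@Pr_gt0 _ _ _ _ _ _ _ x); rewrite !eqxx.
Qed.

(** Three cases: if [k] is the first endpoint of an edge, the block is that pair and [edge_ratio]
    corrects for its dependence; if [k] is a second endpoint, the block is empty and both sides are
    [1]; otherwise the block is the singleton of [k]. *)
Lemma block_cond (y : bool) (s : config) (k : 'I_m) :
  Pr (fun x => (x.1 == y) && block_agree s k x.2) / PY y =
  (\prod_(i | block i == k) source_cond (y, s) i) *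
  \prod_(e in E | e.1 == k) edge_ratio (y, s) e.
Proof.
have p0 := PY_gt0 thY th thE E y.
have [/exists_inP[e eE /eqP <-]|] := boolP [exists e in E, e.1 == k].
  rewrite (eq_bigl _ _ (fun i => block_eq_fst i eE)) (bigD1 e.1) ?eqxx //=.
  rewrite (big_pred1 e.2) => [|i /=]; last first.
    case: eqVneq => [->|] /=; last by rewrite andbT.
    by rewrite (negbTE (matching_fst_snd eE eE)).
  rewrite (big_pred1 e) => [|f /=]; last first.
    apply/andP/eqP => [[fE /eqP fe]|->//].
    by apply: (@matching_inj f e e.1); rewrite // -?fe !inE eqxx.
  rewrite /source_cond /edge_ratio /=.
  have -> : Pr (fun x => (x.1 == y) && block_agree s e.1 x.2) =
      Pr (fun x => [&& x.1 == y, x.2 e.1 == s e.1 & x.2 e.2 == s e.2]).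
    apply: eq_bigl => x; congr (_ && _); apply/forallP/andP => [h|[h1 h2] i].
      by have := h e.1; have := h e.2; rewrite !block_eq_fst // !eqxx orbT !implyTb => -> ->.
    by rewrite block_eq_fst //; apply/implyP => /orP[] /eqP ->.
  have q1 := source_pr_gt0 (y, s) e.1; have q2 := source_pr_gt0 (y, s) e.2.
  move: q1 q2 => /=; set a := Pr (fun x => _ && (_ == s e.1)).
  set b := Pr (fun x => _ && (_ == s e.2)); set c := Pr _ => a0 b0.
  by field; rewrite !gt_eqF.
rewrite negb_exists_in => /forall_inP h1.
rewrite [X in _ = _ * X]big_pred0 ?mulr1 => [|e]; last first.
  by apply/negP => /andP[/h1 /negP].
have [/exists_inP[e eE /eqP <-]|] := boolP [exists e in E, e.2 == k].
  rewrite big_pred0 => [|i]; last exact: block_eq_snd.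
  rewrite (_ : Pr _ = PY y) ?divff ?gt_eqF //; apply: eq_bigl => x.
  by rewrite (_ : block_agree _ _ _) ?andbT //; apply/forallP => i; rewrite block_eq_snd.
rewrite negb_exists_in => /forall_inP h2.
have hk i : (block i == k) = (i == k).
  by apply: block_eq_unmatched => e eE; rewrite h1 ?h2.
rewrite (big_pred1 k) //; congr (_ / _); apply: eq_bigl => x; congr (_ && _).
apply/forallP/idP => [/(_ k)|h i]; first by rewrite hk eqxx.
by rewrite hk; apply/implyP => /eqP ->.
Qed.

Lemma P_factorization (x : outcome) :
  P x / PY x.1 = (\prod_i source_cond x i) * \prod_(e in E) edge_ratio x e.
Proof.
case: x => y s; rewrite P_cond_block.
rewrite [X in _ = X * _](partition_big block xpredT) //=.
rewrite [X in _ = _ * X](partition_big (fun e : 'I_m * 'I_m => e.1) xpredT) //=.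
by rewrite -big_split; apply: eq_bigr => k _; exact: block_cond.
Qed.

Lemma cmiE i j : cmi thY th thE E i j = \sum_x P x * ln (edge_ratio x (i, j)).
Proof.
rewrite /cmi (partition_big (fun x : outcome => x.1) xpredT) //=.
apply: eq_bigr => y _; rewrite (partition_big (fun x : outcome => x.2 i) xpredT) //=.
apply: eq_bigr => a _; rewrite (partition_big (fun x : outcome => x.2 j) xpredT) //=.
apply: eq_bigr => b _; rewrite {1}/Pr mulr_suml.
apply: eq_big => [x|x /and3P[/eqP e1 /eqP e2 /eqP e3]]; first by rewrite andbA.
by rewrite /edge_ratio /= e1 e2 e3.
Qed.

Lemma B_IE : B_I thY th thE E =
  \sum_x P x * (ln (P x) - ln (PY x.1) - \sum_i ln (source_cond x i)).
Proof.
rewrite /B_I; under eq_bigr => e _ do rewrite cmiE -surjective_pairing.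
rewrite exchange_big; apply: eq_bigr => x _; rewrite -mulr_sumr; congr (_ * _).
have := P_factorization x => /(congr1 (@ln R)).
rewrite ln_div ?posrE ?P_gt0 ?PY_gt0 // => ->.
have g0 i := source_cond_gt0 x i; have r0 e := edge_ratio_gt0 x e.
rewrite lnM ?posrE ?prodr_gt0 // !ln_prod //.
by rewrite addrC addKr.
Qed.

End Matching.

(** * The learned model *)

Section Learning.
Variables (R : realType) (m : nat) (thY : R) (th : 'I_m -> R)
  (thE : 'I_m -> 'I_m -> R) (E : {set 'I_m * 'I_m}).
Hypothesis E_lt : forall e, e \in E -> (e.1 < e.2)%N.
Hypothesis E_disjoint : forall e f, e \in E -> f \in E -> e != f ->
  [disjoint [set e.1; e.2] & [set f.1; f.2]].

Local Notation outcome := (outcome m).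
Local Notation P := (P thY th thE E).
Local Notation Pr := (Pr thY th thE E).
Local Notation PY := (PY thY th thE E).
Local Notation Plam := (Plam thY th thE E).
Local Notation config := {ffun 'I_m -> bool}.
Local Notation Esample := (Esample P).
Local Notation H := (cond_entropy thY th thE E).
Local Notation BI := (B_I thY th thE E).
Local Notation agr i b := (agreement i b : pred outcome).

Lemma Pr_ge0 (A : pred outcome) : 0 <= Pr A.
Proof. by apply: sumr_ge0 => x _; rewrite P_ge0. Qed.

Lemma PrE (A : pred outcome) : Pr A = \sum_x P x * (A x)%:R.
Proof.
rewrite /Defs.Pr big_mkcond; apply: eq_bigr => x _.
by case: (A x); rewrite ?mulr1 ?mulr0.
Qed.

Lemma Pr_le1 (A : pred outcome) : Pr A <= 1.
Proof.
rewrite -(P_sum1 thY th thE E) PrE; apply: ler_sum => x _.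
by rewrite ler_piMr ?P_ge0 //; case: (A x).
Qed.

Definition deviation (A : pred outcome) (x : outcome) : R := (A x)%:R - Pr A.

Lemma deviation_mean0 (A : pred outcome) : \sum_x P x * deviation A x = 0.
Proof.
under eq_bigr => x _ do rewrite mulrBr.
by rewrite sumrB -PrE -[X in _ - X]mulr_suml P_sum1 mul1r subrr.
Qed.

Lemma deviation_le1 (A : pred outcome) x : `|deviation A x| <= 1.
Proof.
have := Pr_ge0 A; have := Pr_le1 A; rewrite /deviation.
by case: (A x) => /= h0 h1; rewrite ler_norml; lra.
Qed.

Lemma deviation_variance (A : pred outcome) :
  \sum_x P x * deviation A x ^+ 2 = Pr A * (1 - Pr A).
Proof.
transitivity (\sum_x (P x * (A x)%:R * (1 - 2 * Pr A) + P x * Pr A ^+ 2)).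
  by apply: eq_bigr => x _; rewrite /deviation; case: (A x) => /=; ring.
by rewrite big_split /= -[X in X + _]mulr_suml -[X in _ + X]mulr_suml -PrE P_sum1; ring.
Qed.

(** * Empirical frequencies and the risk of a fixed dataset *)

Variable n : nat.
Hypothesis n_gt0 : (0 < n)%N.
Local Notation dataset := (dataset m n).

Let n_neq0 : n%:R != 0 :> R. Proof. by rewrite pnatr_eq0 -lt0n. Qed.
Let n_pos : 0 < n%:R :> R. Proof. by rewrite ltr0n. Qed.

Definition emp (D : dataset) (A : pred outcome) : R :=
  n%:R^-1 * (#|[set t | A (D t)]|)%:R.

Lemma empE D A : emp D A = sample_mean D (fun x => (A x)%:R).
Proof.
rewrite /emp /sample_mean -sum1_card natr_sum big_mkcond; congr (_ * _).
by apply: eq_bigr => t _; rewrite inE; case: (A _).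
Qed.

Lemma sample_mean_deviation D A : sample_mean D (deviation A) = emp D A - Pr A.
Proof.
rewrite empE /sample_mean sumrB mulrBr; congr (_ - _).
by rewrite sumr_const card_ord -[X in _ * X]mulr_natl mulrA mulVf ?mul1r.
Qed.

Lemma emp_le1 D A : emp D A <= 1.
Proof.
rewrite /emp mulrC ler_pdivrMr // mul1r ler_nat.
by rewrite (leq_trans (max_card _)) ?card_ord.
Qed.

Lemma emp_ge D A : emp D A != 0 -> n%:R^-1 <= emp D A.
Proof.
rewrite /emp mulf_eq0 negb_or => /andP[_]; rewrite pnatr_eq0 -lt0n => c0.
by rewrite ler_peMr ?invr_ge0 ?(ltW n_pos) // ler1n.
Qed.

Lemma emp_gt0 D A : emp D A != 0 -> 0 < emp D A.
Proof. by move=> /emp_ge; apply: lt_le_trans; rewrite invr_gt0. Qed.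

Lemma emp_witness (D : dataset) (A : pred outcome) t : A (D t) -> emp D A != 0.
Proof.
move=> At; rewrite mulf_neq0 ?invr_neq0 // pnatr_eq0 -lt0n card_gt0.
by apply/set0Pn; exists t; rewrite inE.
Qed.

(** The indicator of an agreement event is [(1 + lambda_i * Y) / 2] or [(1 - lambda_i * Y) / 2];
    average it over the dataset. *)
Lemma Ptilde_srcE D i s y : Ptilde_src R D i s y = emp D (agreement i (s == y)).
Proof.
have aE x c : (agreement i c x)%:R = (1 + spin R c * (spin R (x.2 i) * spin R x.1)) / 2 :> R.
  by rewrite /agreement /spin; case: (x.2 i); case: x.1; case: c => /=; field.
transitivity ((1 + spin R (s == y) * acc_est R D i) / 2).
  by rewrite /Ptilde_src /spin; case: y; case: s => /=; ring.
rewrite empE /sample_mean; under eq_bigr => t _ do rewrite aE.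
rewrite -mulr_suml big_split /= sumr_const card_ord -mulr_sumr /acc_est.
by rewrite [RHS]mulrA mulrDr mulVf // [in RHS]mulrCA.
Qed.

Lemma PhatE D s : Phat R D s = emp D (fun x => x.2 == s).
Proof. by []. Qed.

Lemma lossE (D : dataset) (x : outcome) :
  loss thY th thE E D x = - ln (Ptilde_Y thY th thE E D x.1 x.2).
Proof. by case: x => [[] s]; rewrite /loss /spin /=; field. Qed.

Definition risk (D : dataset) : R := \sum_x P x * loss thY th thE E D x.

(** On such datasets all the empirical frequencies entering the loss are positive, so no logarithm
    is taken at [0]. *)
Definition covers (D : dataset) : bool := [forall x, exists t, D t == x].

Lemma emp_covers_gt0 (D : dataset) (A : pred outcome) x : covers D -> A x -> 0 < emp D A.
Proof.
move=> /forallP /(_ x) /existsP[t /eqP e] Ax; apply: emp_gt0.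
by apply: (@emp_witness _ _ t); rewrite e.
Qed.

Lemma agreement_witness i b : {x : outcome | agreement i b x}.
Proof. by exists (b, [ffun=> true]); rewrite /agreement ffunE /=; case: b. Qed.

Lemma Pr_agreement_gt0 i b : 0 < Pr (agr i b).
Proof. by have [x] := agreement_witness i b; apply: Pr_gt0. Qed.

Lemma sum_agreement i (F : bool -> R) :
  \sum_x P x * F (x.2 i == x.1) = \sum_(b : bool) Pr (agr i b) * F b.
Proof.
rewrite (partition_big (fun x : outcome => x.2 i == x.1) xpredT) //=.
by apply: eq_bigr => b _; rewrite mulr_suml; apply: eq_bigr => x /eqP ->.
Qed.

Lemma source_condE x i :
  source_cond thY th thE E x i = Pr (agr i (x.2 i == x.1)).
Proof. exact: Pr_source_cond. Qed.

Lemma Plam_gt0 s : 0 < Plam s.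
Proof. by apply: (@Pr_gt0 _ _ _ _ _ _ _ (true, s)) => /=. Qed.

Lemma sum_over_lambda (F : config -> R) : \sum_x P x * F x.2 = \sum_s Plam s * F s.
Proof.
rewrite (partition_big (fun x : outcome => x.2) xpredT) //=.
by apply: eq_bigr => s _; rewrite mulr_suml; apply: eq_bigr => x /eqP ->.
Qed.

Lemma ln_le_subr1 (x : R) : 0 < x -> ln x <= x - 1.
Proof.
move=> x0; rewrite -[in leLHS](subrK 1 x) addrC.
by apply: le_ln1Dx; rewrite ltrBrDr addrC subrr.
Qed.

(* Gibbs' inequality: replacing the law of [lambda] by its empirical version
   can only decrease this term. *)
Lemma sum_ln_Phat_le0 D : covers D ->
  \sum_x P x * (ln (Phat R D x.2) - ln (Plam x.2)) <= 0.
Proof.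
move=> gD; rewrite (sum_over_lambda (fun s => ln (Phat R D s) - ln (Plam s))).
have h0 s : 0 < Phat R D s.
  by rewrite PhatE; apply: (@emp_covers_gt0 _ _ (true, s)) => //=.
apply: le_trans (_ : \sum_s (Phat R D s - Plam s) <= _).
  apply: ler_sum => s _; have p0 := Plam_gt0 s.
  rewrite -ln_div ?posrE // (le_trans (ler_wpM2l (ltW p0) (ln_le_subr1 _))) ?divr_gt0 //.
  by rewrite mulrBr mulr1 mulrCA mulfV ?mulr1 ?gt_eqF.
have -> : \sum_s (Phat R D s - Plam s) = \sum_s Phat R D s - 1.
  rewrite sumrB; congr (_ - _); have := sum_over_lambda (fun=> 1).
  under eq_bigr => x _ do rewrite mulr1.
  by rewrite P_sum1 => ->; apply: eq_bigr => s _; rewrite mulr1.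
rewrite subr_le0 -mulr_sumr -natr_sum mulrC ler_pdivrMr // mul1r ler_nat.
rewrite [leqRHS](_ : n = \sum_s \sum_(t < n | (D t).2 == s) 1)%N; last first.
  transitivity (\sum_(t < n) 1)%N; first by rewrite sum_nat_const card_ord muln1.
  exact: (partition_big (fun t => (D t).2) xpredT).
apply: leq_sum => s _; rewrite -sum1_card; apply/eq_leq/eq_bigl => t.
by rewrite inE.
Qed.

(** Outcome by outcome, add and subtract the logarithms of the true source conditionals. Together
    with [ln (P x)] and the class balance of the inference rule they form the summand of [B_IE]. *)
Lemma risk_covers D : covers D -> risk D - H =
  BI + \sum_i \sum_(b : bool)
         Pr (agr i b) * - ln (emp D (agr i b) / Pr (agr i b))
     + \sum_x P x * (ln (Phat R D x.2) - ln (Plam x.2)).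
Proof.
move=> gD; rewrite (B_IE thY th thE E_lt E_disjoint) /cond_entropy opprK /risk.
have a0 i b : 0 < emp D (agr i b).
  by have [x] := agreement_witness i b; apply: emp_covers_gt0.
have p0 i b := Pr_agreement_gt0 i b.
have -> : \sum_i \sum_(b : bool) Pr (agr i b) * - ln (emp D (agr i b) / Pr (agr i b)) =
   \sum_x P x * \sum_i (ln (Pr (agr i (x.2 i == x.1))) - ln (emp D (agr i (x.2 i == x.1)))).
  transitivity (\sum_i \sum_x P x *
      (ln (Pr (agr i (x.2 i == x.1))) - ln (emp D (agr i (x.2 i == x.1))))); last first.
    by rewrite exchange_big; apply: eq_bigr => x _; rewrite mulr_sumr.
  apply: eq_bigr => i _.
  rewrite (sum_agreement i (fun b => ln (Pr (agr i b)) - ln (emp D (agr i b)))).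
  by apply: eq_bigr => b _; rewrite ln_div ?posrE // opprB.
rewrite -!big_split; apply: eq_bigr => x _ /=; rewrite -!mulrDr; congr (_ * _).
rewrite lossE /Ptilde_Y.
have h0 : 0 < Phat R D x.2 by rewrite PhatE; apply: (@emp_covers_gt0 _ _ x).
have s0 : 0 < \prod_i Ptilde_src R D i (x.2 i) x.1.
  by apply: prodr_gt0 => i _; rewrite Ptilde_srcE.
have e1 : ln (\prod_i Ptilde_src R D i (x.2 i) x.1) =
    \sum_i ln (emp D (agr i (x.2 i == x.1))).
  by rewrite ln_prod => [|i _]; [apply: eq_bigr => i _|]; rewrite Ptilde_srcE.
have e2 : \sum_i ln (source_cond thY th thE E x i) =
    \sum_i ln (Pr (agr i (x.2 i == x.1))).
  by apply: eq_bigr => i _; rewrite source_condE.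
have q0 := P_gt0 thY th thE E x.
rewrite sumrB -e1 -e2; move: (Phat R D x.2) h0 (P x) q0 => h h0 q q0.
rewrite !ln_div ?lnM ?posrE ?mulr_gt0 ?PY_gt0 ?Plam_gt0 //.
by ring.
Qed.

(** A nonzero frequency is at least [1 / n]; every factor [ln n] in the error terms comes from
    here. *)
Lemma ln_emp_ge D A : emp D A != 0 -> - ln (emp D A) <= ln n%:R.
Proof.
move=> a0; rewrite lerNl -lnV ?posrE // ler_ln ?posrE ?invr_gt0 ?emp_gt0 //.
exact: emp_ge.
Qed.

Lemma ln_n_ge0 : 0 <= ln n%:R :> R.
Proof. by rewrite ln_ge0 // ler1n. Qed.

(* Whenever [Ptilde_Y D x.1 x.2 = 0] the convention [ln 0 = 0] makes the loss
   vanish; otherwise every factor of [Ptilde_Y] is at least [1 / n]. *)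
Lemma loss_le (D : dataset) (x : outcome) :
  loss thY th thE E D x <= `|ln (PY x.1)| + m%:R * ln n%:R.
Proof.
rewrite lossE; have lnn0 := ln_n_ge0.
have [->|] := eqVneq (Ptilde_Y thY th thE E D x.1 x.2) 0.
  by rewrite ln0 // oppr0 addr_ge0 ?mulr_ge0 ?normr_ge0.
rewrite /Ptilde_Y !mulf_eq0 !negb_or invr_eq0 => /andP[/andP[s0 _] h0].
have s1 i : emp D (agr i (x.2 i == x.1)) != 0.
  by rewrite -Ptilde_srcE; move/prodf_neq0: s0; apply.
have h1 : 0 < Phat R D x.2 by rewrite PhatE emp_gt0.
have s2 i : 0 < Ptilde_src R D i (x.2 i) x.1 by rewrite Ptilde_srcE emp_gt0.
have s3 : 0 < \prod_i Ptilde_src R D i (x.2 i) x.1 by apply: prodr_gt0.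
rewrite ln_div ?posrE //; last by rewrite mulr_gt0 ?PY_gt0.
rewrite lnM ?posrE ?PY_gt0 // ln_prod //.
have l1 : ln (Phat R D x.2) <= 0 by rewrite ln_le0 // PhatE emp_le1.
have l2 : - ln (PY x.1) <= `|ln (PY x.1)| by rewrite -normrN ler_norm.
have : - \sum_i ln (Ptilde_src R D i (x.2 i) x.1) <= m%:R * ln n%:R.
  rewrite -sumrN -[m in leRHS]card_ord mulr_natl -sumr_const; apply: ler_sum => i _.
  by rewrite Ptilde_srcE ln_emp_ge.
by lra.
Qed.

Lemma risk_le D : risk D <= `|ln (PY true)| + `|ln (PY false)| + m%:R * ln n%:R.
Proof.
set B := leRHS.
have -> : B = \sum_x P x * B by rewrite -mulr_suml P_sum1 mul1r.
apply: ler_sum => x _; apply: ler_wpM2l; first exact: P_ge0.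
apply: le_trans (loss_le _ _) _; rewrite lerD2r.
by case: x.1; rewrite ?lerDl ?lerDr.
Qed.

(** A missing outcome has empirical frequency [0], so its own term equals [1]. This bounds the
    indicator of the bad event by fourth powers of deviations, as in Markov's inequality. *)
Lemma not_covers_le D : ~~ covers D ->
  1 <= \sum_x (emp D (pred1 x) - P x) ^+ 4 / P x ^+ 4.
Proof.
move=> /forallPn[x /existsPn hx]; rewrite (bigD1 x) //=.
have -> : emp D (pred1 x) = 0.
  apply/eqP; rewrite /emp mulf_eq0 pnatr_eq0 cards_eq0; apply/orP; right.
  by apply/eqP/setP => t; rewrite !inE; apply/negbTE/hx.
rewrite sub0r exprNn -signr_odd /= mul1r mulfV ?expf_neq0 ?gt_eqF ?P_gt0 //.
rewrite lerDl; apply: sumr_ge0 => y _.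
by rewrite divr_ge0 ?exprn_even_ge0.
Qed.

(** * Bounding the excess risk and its expectation *)

Variables (eta K : R).
Hypotheses (eta_gt0 : 0 < eta) (K_ge0 : 0 <= K).
Hypothesis lnP : forall u L : R, -1 < u -> 0 <= L -> - ln (1 + u) <= L ->
    - ln (1 + u) <= - u + (1 / 2 + eta) * u ^+ 2 + K * L * u ^+ 4.

(** Apply [lnP] with [u = (a - p) / p] and [L = ln n], where [a] is the empirical frequency and [p]
    the true one, then multiply by [p]. *)
Lemma source_term_le D i : covers D ->
  \sum_(b : bool) Pr (agr i b) * - ln (emp D (agr i b) / Pr (agr i b)) <=
  \sum_(b : bool) ((1 / 2 + eta) / Pr (agr i b) * (emp D (agr i b) - Pr (agr i b)) ^+ 2
    + K * ln n%:R / Pr (agr i b) ^+ 3 * (emp D (agr i b) - Pr (agr i b)) ^+ 4).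
Proof.
move=> gD; have p0 b := Pr_agreement_gt0 i b.
have a0 b : 0 < emp D (agr i b).
  by have [x] := agreement_witness i b; apply: emp_covers_gt0.
have tot (A : pred outcome -> R) : A = emp D \/ A = Pr -> \sum_(b : bool) A (agr i b) = 1.
  have hE x : \sum_(b : bool) (agreement i b x)%:R = 1 :> R.
    by rewrite big_bool /agreement; case: (_ == x.1) => /=; rewrite ?addr0 ?add0r.
  case=> ->.
    under eq_bigr => b _ do rewrite empE.
    rewrite -mulr_sumr exchange_big /=; under eq_bigr => t _ do rewrite hE.
    by rewrite sumr_const card_ord mulVf.
  under eq_bigr => b _ do rewrite PrE.
  rewrite exchange_big /= -[RHS](P_sum1 thY th thE E); apply: eq_bigr => x _.
  by rewrite -mulr_sumr hE mulr1.
(* The linear terms cancel because both the empirical and the true law have total mass [1]. *)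
have t0 : \sum_(b : bool) - (emp D (agr i b) - Pr (agr i b)) = 0.
  by rewrite sumrN sumrB !tot; [rewrite subrr oppr0|right|left].
rewrite -[leRHS]add0r -[X in _ <= X + _]t0 -big_split; apply: ler_sum => b _ /=.
set a := emp _ _; set p := Pr _.
have ap : a / p = 1 + (a - p) / p by field; exact: lt0r_neq0 (p0 b).
have p1 : 0 < p by exact: p0.
have a1 : 0 < a by exact: a0.
have L1 : - ln (a / p) <= ln n%:R.
  rewrite ln_div ?posrE //; have := ln_emp_ge (lt0r_neq0 (a0 b)).
  have : ln p <= 0 by apply/ln_le0/Pr_le1.
  by rewrite -/a; lra.
have u1 : -1 < (a - p) / p by have := divr_gt0 a1 p1; rewrite ap; lra.
rewrite ap in L1 *; have := ler_wpM2l (ltW p1) (lnP u1 ln_n_ge0 L1).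
move/le_trans; apply; rewrite le_eqVlt; apply/orP; left; apply/eqP.
by field; rewrite gt_eqF.
Qed.

(** A single bound valid for every dataset: the last sum is nonnegative, and it exceeds the crude
    risk bound when an outcome is missing. Its expectation only involves second and fourth
    moments. *)
Definition risk_bound (D : dataset) : R :=
  BI + \sum_i \sum_(b : bool)
         ((1 / 2 + eta) / Pr (agr i b) * (emp D (agr i b) - Pr (agr i b)) ^+ 2
          + K * ln n%:R / Pr (agr i b) ^+ 3 * (emp D (agr i b) - Pr (agr i b)) ^+ 4)
     + \sum_x (`|ln (PY true)| + `|ln (PY false)| + `|H| + `|BI| + m%:R * ln n%:R)
         / P x ^+ 4 * (emp D (pred1 x) - P x) ^+ 4.

Lemma risk_le_bound D : risk D - H <= risk_bound D.
Proof.
rewrite /risk_bound; set C : R := `|ln (PY true)| + _ + _ + _ + _.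
set S1 := \sum_i _; set S2 := \sum_x _; have lnn0 := ln_n_ge0.
have mln0 : 0 <= m%:R * ln n%:R :> R by rewrite mulr_ge0.
have C0 : 0 <= C by rewrite /C !addr_ge0.
have S1_ge0 : 0 <= S1.
  apply: sumr_ge0 => i _; apply: sumr_ge0 => b _; have p0 := Pr_agreement_gt0 i b.
  rewrite addr_ge0 // mulr_ge0 ?exprn_even_ge0 // divr_ge0 ?exprn_ge0 ?(ltW p0) //.
  - by have := eta_gt0; lra.
  - by rewrite mulr_ge0.
have S2E : S2 = C * \sum_x (emp D (pred1 x) - P x) ^+ 4 / P x ^+ 4.
  by rewrite mulr_sumr; apply: eq_bigr => x _; rewrite -mulrA; congr (_ * _); exact: mulrC.
have [gD|/not_covers_le bD] := boolP (covers D).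
  rewrite risk_covers //.
  have : 0 <= S2.
    rewrite S2E mulr_ge0 // sumr_ge0 // => x _.
    by rewrite divr_ge0 ?exprn_even_ge0.
  have : \sum_i \sum_(b : bool) Pr (agr i b) * - ln (emp D (agr i b) / Pr (agr i b)) <= S1.
    by apply: ler_sum => i _; exact: source_term_le.
  by have := sum_ln_Phat_le0 gD; lra.
(* The summands [|H|] and [|BI|] of [C] absorb [- H] and [BI], whatever their signs. *)
have : C <= S2 by rewrite S2E ler_peMr.
have : - H <= `|H| by rewrite -normrN ler_norm.
have : - BI <= `|BI| by rewrite -normrN ler_norm.
by have := risk_le D; rewrite /C; lra.
Qed.

Lemma Esample_dev2 (A : pred outcome) :
  Esample (fun D : dataset => (emp D A - Pr A) ^+ 2) = n%:R^-1 * (Pr A * (1 - Pr A)).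
Proof.
rewrite -deviation_variance.
rewrite -(sample_mean_moment2 (P_sum1 thY th thE E) (deviation_mean0 A) n_gt0).
by apply: eq_Esample => D; rewrite sample_mean_deviation.
Qed.

Hypothesis n_ge4 : (4 <= n)%N.

Lemma Esample_dev4 (A : pred outcome) :
  Esample (fun D : dataset => (emp D A - Pr A) ^+ 4) <= 512 * expR 2 / n%:R ^+ 2.
Proof.
have := sample_mean_moment4 (P_ge0 thY th thE E) (P_sum1 thY th thE E)
  (deviation_mean0 A) (deviation_le1 A) n_ge4.
by under eq_Esample => D do rewrite sample_mean_deviation.
Qed.

Lemma excess_errorE :
  excess_error thY th thE E n = Esample (fun D : dataset => risk D - H).
Proof.
by rewrite EsampleD Esample_cst //; exact: P_sum1.
Qed.

Lemma excess_error_le :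
  excess_error thY th thE E n <=
  m%:R * (1 / 2 + eta) / n%:R + BI +
  ((\sum_i \sum_(b : bool) K / Pr (agr i b) ^+ 3) * ln n%:R +
   (`|ln (PY true)| + `|ln (PY false)| + `|H| + `|BI| + m%:R * ln n%:R) *
     \sum_x (P x ^+ 4)^-1) * (512 * expR 2 / n%:R ^+ 2).
Proof.
rewrite excess_errorE; apply: le_trans (ler_Esample (P_ge0 thY th thE E) risk_le_bound) _.
rewrite /risk_bound; set C : R := `|ln (PY true)| + _ + _ + _ + _.
set M := 512 * expR 2 / _.
have C0 : 0 <= C by rewrite /C !addr_ge0 // mulr_ge0 // ln_n_ge0.
rewrite !EsampleD (Esample_cst (P_sum1 thY th thE E)) !Esample_sum.
have M_bound (A : pred outcome) (c : R) : 0 <= c ->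
    Esample (fun D : dataset => c * (emp D A - Pr A) ^+ 4) <= c * M.
  by move=> c0; rewrite EsampleZ ler_wpM2l // Esample_dev4.
have hS : \sum_i Esample (fun D : dataset => \sum_(b : bool)
      ((1 / 2 + eta) / Pr (agr i b) * (emp D (agr i b) - Pr (agr i b)) ^+ 2
      + K * ln n%:R / Pr (agr i b) ^+ 3 * (emp D (agr i b) - Pr (agr i b)) ^+ 4)) <=
    m%:R * (1 / 2 + eta) / n%:R +
    (\sum_i \sum_(b : bool) K / Pr (agr i b) ^+ 3) * ln n%:R * M.
  have -> : m%:R * (1 / 2 + eta) / n%:R = \sum_(i < m) (1 / 2 + eta) / n%:R.
    by rewrite sumr_const card_ord -[RHS]mulr_natl mulrA.
  rewrite !mulr_suml -big_split; apply: ler_sum => i _ /=.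
  rewrite Esample_sum !mulr_suml.
  (* The second moment [p (1 - p) / n], divided by [p], leaves [(1 - p) / n]; over the two values of
     [b] these add up to [(2 - 1) / n]. *)
  have -> : (1 / 2 + eta) / n%:R = \sum_(b : bool) (1 / 2 + eta) / n%:R * (1 - Pr (agr i b)).
    rewrite -mulr_sumr big_bool /=.
    have : Pr (agr i true) + Pr (agr i false) = 1.
      have := sum_agreement i (fun=> 1); under eq_bigr => x _ do rewrite mulr1.
      by rewrite P_sum1 big_bool /= !mulr1.
    by move=> tot; rewrite [X in _ = _ * X](_ : _ = 1) ?mulr1 //; lra.
  rewrite -big_split; apply: ler_sum => b _ /=; have p0 := Pr_agreement_gt0 i b.
  rewrite EsampleD; apply: lerD.
    rewrite EsampleZ Esample_dev2 le_eqVlt; apply/orP; left; apply/eqP.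
    by field; rewrite n_neq0 gt_eqF.
  apply: le_trans (M_bound _ _ _) _.
    by rewrite divr_ge0 ?exprn_ge0 ?(ltW p0) // mulr_ge0 // ln_n_ge0.
  by rewrite [K * _ / _]mulrAC.
have hT : \sum_x Esample (fun D : dataset =>
      C / P x ^+ 4 * (emp D (pred1 x) - P x) ^+ 4) <= C * (\sum_x (P x ^+ 4)^-1) * M.
  have -> : C * (\sum_x (P x ^+ 4)^-1) * M = \sum_x C / P x ^+ 4 * M.
    by rewrite -mulr_suml -mulr_sumr.
  apply: ler_sum => x _.
  have := M_bound (pred1 x) (C / P x ^+ 4).
  rewrite /Defs.Pr big_pred1_eq; apply.
  by rewrite divr_ge0 // exprn_even_ge0.
by move: hS hT; rewrite -!mulrA; lra.
Qed.

End Learning.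

(** * Passage to large samples *)

(** Sublinearity of [ln] at [c n] gives [ln n <= c n - ln c]. The choice of [c] makes
    [B c <= eps / 2], the [+ 1] guarding against [B = 0]; the constants fit in the other half of
    [eps n] once [n] is large. *)
Lemma ln_natr_little_o (R : realType) (A B eps : R) :
  0 <= B -> 0 < eps ->
  exists N : nat, forall n : nat, (N <= n)%N -> A + B * ln n%:R <= eps * n%:R.
Proof.
move=> B0 eps0; pose c := eps / (2 * (B + 1)).
have B1 : 0 < B + 1 by lra.
have c0 : 0 < c by rewrite divr_gt0 // mulr_gt0.
pose C := (A - B * ln c) / (eps / 2).
exists (Num.truncn `|C|).+1 => n nN.
have n0 : 0 < n%:R :> R by rewrite ltr0n (leq_trans _ nN).
have h1 : ln n%:R <= c * n%:R - ln c.
  have := ln_sublinear (mulr_gt0 c0 n0); rewrite lnM ?posrE //; lra.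
have h2 : A - B * ln c <= eps / 2 * n%:R.
  rewrite [leRHS]mulrC -ler_pdivrMr ?divr_gt0 //.
  apply: le_trans (ler_norm _) _; apply: le_trans (ltW (truncnS_gt _)) _.
  by rewrite ler_nat.
have h3 : B * c <= eps / 2.
  rewrite /c mulrA ler_pdivrMr ?mulr_gt0 //.
  have -> : eps / 2 * (2 * (B + 1)) = B * eps + eps by field.
  by rewrite lerDl ltW.
have h4 : B * ln n%:R <= B * (c * n%:R - ln c) by rewrite ler_wpM2l.
have h5 : B * c * n%:R <= eps / 2 * n%:R by rewrite ler_wpM2r // ltW.
by move: h4 h5; rewrite mulrBr mulrA; lra.
Qed.

Theorem theorem2 (R : realType) (m : nat) (thY : R) (th : 'I_m -> R)
    (thE : 'I_m -> 'I_m -> R) (E : {set 'I_m * 'I_m}) :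
  0 <= thY ->
  (forall i, 0 <= th i) ->
  (forall e, e \in E -> 0 <= thE e.1 e.2) ->
  (forall e, e \in E -> (e.1 < e.2)%N) ->
  (forall e f, e \in E -> f \in E -> e != f ->
     [disjoint [set e.1; e.2] & [set f.1; f.2]]) ->
  (* R_L^e <= m/(2 n_L) + B_I + o(1/n_L)  as n_L -> oo *)
  forall eps : R, 0 < eps ->
  exists N : nat, forall n : nat, (N <= n)%N ->
    excess_error thY th thE E n
      <= m%:R / (2 * n%:R) + B_I thY th thE E + eps / n%:R.
Proof.
move=> _ _ _ E_lt E_disj eps eps0.
(* Chosen so that [m * eta <= eps / 2]; the [+ 1] covers [m = 0]. *)
pose eta := eps / (2 * (m%:R + 1)).
have m1 : 0 < m%:R + 1 :> R by rewrite ltr_wpDl.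
have eta0 : 0 < eta by rewrite divr_gt0 // mulr_gt0.
have [K K0 lnP] := ln_ge_quartic eta0.
pose pr i b := Pr thY th thE E (agreement i b).
pose S := \sum_(i < m) \sum_(b : bool) K / pr i b ^+ 3.
pose C : R := `|ln (PY thY th thE E true)| + `|ln (PY thY th thE E false)| +
  `|cond_entropy thY th thE E| + `|B_I thY th thE E|.
pose T := \sum_x (P thY th thE E x ^+ 4)^-1.
pose M : R := 512 * expR 2.
have M0 : 0 <= M by rewrite mulr_ge0 ?expR_ge0.
have T0 : 0 <= T by apply: sumr_ge0 => x _; rewrite invr_ge0 exprn_even_ge0.
have S0 : 0 <= S.
  apply: sumr_ge0 => i _; apply: sumr_ge0 => b _.
  by rewrite divr_ge0 // exprn_ge0 // ltW // Pr_agreement_gt0.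
have B0 : 0 <= (S + m%:R * T) * M by rewrite mulr_ge0 // addr_ge0 // mulr_ge0.
(* The other half of [eps] pays for the remainder: [n^2] times it is [C T M + (S + m T) M ln n], to
   be at most [(eps / 2) n]. *)
have [N hN] := @ln_natr_little_o R (C * T * M) _ (eps / 2) B0 (divr_gt0 eps0 (ltr0n _ 2)).
(* The [4] is the threshold of the fourth moment bound. *)
exists (maxn N 4) => n; rewrite geq_max => /andP[/hN {}hN n4].
have n0 : (0 < n)%N by exact: leq_trans n4.
have np : 0 < n%:R :> R by rewrite ltr0n.
have := @excess_error_le R m thY th thE E E_lt E_disj n n0 eta K eta0 K0 lnP n4.
rewrite -/pr -/S -/C -/T -/M => /le_trans; apply.
have h1 : m%:R * eta <= eps / 2.
  rewrite /eta mulrA ler_pdivrMr ?mulr_gt0 //.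
  have -> : eps / 2 * (2 * (m%:R + 1)) = m%:R * eps + eps by field.
  by rewrite lerDl ltW.
have h2 : (S * ln n%:R + (C + m%:R * ln n%:R) * T) * (M / n%:R ^+ 2) <= eps / 2 / n%:R.
  rewrite expr2 invfM !mulrA ler_wpM2r ?invr_ge0 ?(ltW np) // ler_pdivrMr //.
  by apply: le_trans hN; rewrite le_eqVlt; apply/orP; left; apply/eqP; rewrite /M; ring.
have h3 : m%:R * eta / n%:R <= eps / 2 / n%:R.
  by rewrite ler_wpM2r ?invr_ge0 ?(ltW np).
have -> : m%:R / (2 * n%:R) = m%:R * (1 / 2) / n%:R :> R by field; rewrite gt_eqF.
have -> : eps / n%:R = eps / 2 / n%:R + eps / 2 / n%:R by field; rewrite gt_eqF.
by rewrite mulrDr mulrDl; lra.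
Qed.
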